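(* Every Sturmian word $\mathbf{s}$ satisfies $\mathrm{rep}(\mathbf{s})\le \sqrt{10}-\frac32$.
   Context: A Sturmian word is an infinite word $\mathbf{s}$ over a finite alphabet whose number $p(n,\mathbf{s})$ of distinct factors of length $n$ equals $n+1$ for every $n\ge1$. For an infinite word $\mathbf{x}=x_1x_2\ldots$, with $x_i^j=x_i\cdots x_j$, let $r(n,\mathbf{x})=\min\{m\ge1:\ x_i^{i+n-1}=x_{m-n+1}^{m}\text{ for some } 1\le i\le m-n\}$, and $\mathrm{rep}(\mathbf{x})=\liminf_{n\to\infty} r(n,\mathbf{x})/n$. *)

(* Defs.v *)
From mathcomp Require Import all_boot all_order all_algebra.
From mathcomp Require Import all_classical all_reals all_analysis.
Set Implicit Arguments. Unset Strict Implicit. Unset Printing Implicit Defensive.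
Import Order.TTheory GRing.Theory Num.Theory.

(* An infinite word x = x_1 x_2 ... over the finite alphabet T is a map
   x : nat -> T, with the paper's letter x_i (i >= 1) being  x i.-1. *)

(* factor x i n = x_i^{i+n-1} = x_i ... x_{i+n-1}  (1-based i, length n) *)
Definition factor (T : Type) (x : nat -> T) (i n : nat) : seq T :=
  mkseq (fun k => x (i.-1 + k)) n.

Definition factors_of_length (T : finType) (x : nat -> T) (n : nat)
  : {set n.-tuple T} :=
  [set w : n.-tuple T | `[< exists i, 1 <= i /\ factor x i n = tval w >] ].

Definition complexity (T : finType) (x : nat -> T) (n : nat) : nat :=
  #|factors_of_length x n|.

Definition sturmian (T : finType) (s : nat -> T) : Prop :=
  forall n, 1 <= n -> complexity s n = n.+1.

Definition rcond (T : Type) (x : nat -> T) (n m : nat) : Prop :=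
  1 <= m /\ exists i, 1 <= i /\ i <= m - n /\ factor x i n = factor x (m - n + 1) n.

(* r(n,x) = min { m >= 1 : x_i^{i+n-1} = x_{m-n+1}^m for some 1 <= i <= m-n }
   (set to 0 if no such m exists; this never happens over a finite alphabet) *)
Definition rfun (T : Type) (x : nat -> T) (n : nat) : nat :=
  match pselect (exists m, `[< rcond x n m >]) with
  | left ex => ex_minn ex
  | right _ => 0
  end.

Definition rep (R : realType) (T : Type) (x : nat -> T) : \bar R :=
  limn_einf (fun n => ((rfun x n)%:R / n%:R : R)%:E).

(* Main.v *)
(* If s agrees with itself from positions i < j on along n letters, then
   r(n, s) <= j + n; so it is enough to find long early repetitions in s.
   A Sturmian word has at most one right special factor of each length, and this
   passes to the word obtained by grouping each isolated letter with the letter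
   before it. Iterating, s is at every level a concatenation of two blocks, up
   to a cut first block, and consecutive levels are related by one of three linear
   moves on triples (u, v, d) of lengths. Assume that r(n, s) >= C n for some
   C > sqrt 10 - 3/2 and all large n. The repetitions visible at one level give
   linear inequalities between u, v, d that force the sequence of moves to be
   eventually periodic, with one possible period of length 4 (continued fraction
   period 2, 1, 1). Along that sequence (u, v) grows like powers of 3 + sqrt 10,
   and the repetitions met there contradict the choice of C. *)

From HB Require Import structures.
Require Import Defs.
From mathcomp Require Import all_boot all_order all_algebra.
From mathcomp Require Import all_classical all_reals all_analysis.
From mathcomp Require Import zify ring lra.
Import Order.TTheory GRing.Theory Num.Theory.
Set Implicit Arguments.
Unset Strict Implicit.
Unset Printing Implicit Defensive.
Local Open Scope nat_scope.

(** * Linear dynamics of the block lengths *)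

(* A configuration (u, v, d) records the length u of the block in which the word
   starts, the length v of the other block, and the length d <= u of the part of
   the first block that is present. A move is one desubstitution step. *)
Inductive move := Stay | Swap | Grow.

Definition move_eqb (m m' : move) : bool :=
  match m, m' with
  | Stay, Stay | Swap, Swap | Grow, Grow => true
  | _, _ => false
  end.

Lemma move_eqP : Equality.axiom move_eqb.
Proof. by case=> -[]; constructor. Qed.

HB.instance Definition _ := hasDecEq.Build move move_eqP.

Definition act (m : move) (c : nat * nat * nat) : nat * nat * nat :=
  let: (u, v, d) := c in
  match m with
  | Stay => (u, u + v, d)
  | Swap => (u + v, u, d + v)
  | Grow => (u + v, v, d)
  end.

(* 33/50 is a rational number slightly below sqrt 10 - 5/2. *)
Definition bound (m : move) (c : nat * nat * nat) : Prop :=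
  let: (u, v, d) := c in
  match m with
  | Stay => 33 * (u + v + d) <= 50 * u
  | Swap => 33 * (u + v + d) <= 50 * (u + v)
  | Grow => True
  end.

(** These inequalities come from repetitions that occur when the following move is not [Stay]. *)
Definition next_bound (m : move) (c : nat * nat * nat) : Prop :=
  let: (u, v, d) := c in
  match m with
  | Grow => 33 * (u + 2 * v) <= 50 * (v + d)
  | _ => 33 * (2 * u + v) <= 50 * (u + v + d)
  end.

Definition reduced (c : nat * nat * nat) : Prop :=
  let: (u, v, d) := c in [/\ 0 < u, 0 < v & d <= u].

Fixpoint feasible (w : seq move) (c : nat * nat * nat) : Prop :=
  match w with
  | [::] => True
  | m :: w' =>
      bound m c /\ (if w' is m' :: _ then
                      if m' == Stay then True else next_bound m c
                    else True)
      /\ feasible w' (act m c)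
  end.

(* An infinite sequence of moves avoiding these words ends in Grow forever or
   has the eventual period Swap Swap Swap Grow. *)
Definition forbidden : seq (seq move) :=
  [:: [:: Stay; Stay];
      [:: Swap; Stay];
      [:: Stay; Grow; Stay];
      [:: Swap; Grow; Stay];
      [:: Grow; Grow; Stay];
      [:: Grow; Grow; Grow; Swap];
      [:: Grow; Swap; Grow; Swap];
      [:: Grow; Swap; Grow; Grow];
      [:: Swap; Swap; Swap; Swap; Swap];
      [:: Grow; Swap; Swap; Swap; Swap];
      [:: Grow; Grow; Swap; Swap; Swap];
      [:: Grow; Grow; Swap; Swap; Grow; Swap];
      [:: Grow; Grow; Swap; Swap; Grow; Grow];
      [:: Swap; Swap; Grow; Swap; Swap; Grow; Swap];
      [:: Swap; Swap; Grow; Swap; Swap; Grow; Grow]].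

Lemma forbidden_infeasible w c :
  reduced c -> w \in forbidden -> ~ feasible w c.
Proof.
case: c => [[u v] d] /= [u0 v0 du].
rewrite !inE; do ![case/predU1P=> [-> /=|]; first by lia].
by move/eqP=> -> /=; lia.
Qed.

Section Orbit.
Variables (m : nat -> move) (c : nat -> nat * nat * nat).
Hypothesis c_act : forall k, c k.+1 = act (m k) (c k).
Hypothesis c_reduced : forall k, reduced (c k).
Hypothesis c_bound : forall k, bound (m k) (c k).
Hypothesis c_next : forall k, m k.+1 != Stay -> next_bound (m k) (c k).

Lemma feasible_window k n : feasible [seq m i | i <- iota k n] (c k).
Proof.
elim: n k => // n IH k /=; split; first exact: c_bound.
split; last by rewrite -c_act; exact: IH.
case: n {IH} => //= n.
by case E: (_ == _) => //; apply: c_next; rewrite E.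
Qed.

Lemma window_allowed k n : [seq m i | i <- iota k n] \notin forbidden.
Proof.
apply/negP => /(@forbidden_infeasible _ _ (c_reduced k)); apply.
exact: feasible_window.
Qed.

(** [Stay] cannot follow [Stay] or [Swap], nor a [Grow] that has a predecessor; hence the shift by
    two. *)
Lemma no_stay k : m k.+2 != Stay.
Proof.
move: (window_allowed k 3) (window_allowed k.+1 2) => /=.
by case: (m k); case: (m k.+1); case: (m k.+2).
Qed.

Lemma not_always_grow k : exists j, m (k + j) <> Grow.
Proof.
apply: contrapT => H.
have G j : m (k + j) = Grow by apply: contrapT => nG; apply: H; exists j.
case E: (c k) => [[u v] d].
have cE j : c (k + j) = (u + j * v, v, d).
  elim: j => [|j IH]; first by rewrite addn0 E mul0n addn0.
  by rewrite addnS c_act IH G /= mulSn [v + _]addnC addnA.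
(* Constant [Grow] adds [v > 0] to [u] at each step and fixes [v] and [d]; by this index [u] is too
   large for [next_bound]. *)
have := @c_next (k + 50 * (v + d)); rewrite cE G -addnS G => /(_ isT) /=.
have := c_reduced k; rewrite E => -[u0 v0 _].
nia.
Qed.

(** After three [Grow], neither [Swap] nor [Stay] is possible, so [Grow] would persist forever. *)
Lemma no_triple_grow k :
  ~~ [&& m k.+2 == Grow, m k.+3 == Grow & m k.+4 == Grow].
Proof.
apply/negP => G3.
have H j : [&& m (k + j).+2 == Grow, m (k + j).+3 == Grow
            & m (k + j).+4 == Grow].
  elim: j => [|j]; first by rewrite addn0.
  move: (window_allowed (k + j).+2 4) (no_stay (k + j).+3).
  rewrite addnS /=.
  by do 3![case: (m _) => //]; case: (m _).
have [j] := not_always_grow k.+2; apply.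
by case/and3P: (H j) => /eqP.
Qed.

(** Each continuation of [Grow Grow Swap] without [Stay] meets a forbidden word within three more
    moves. *)
Lemma no_double_grow k : ~~ ((m k.+2 == Grow) && (m k.+3 == Grow)).
Proof.
move: (window_allowed k.+2 5) (window_allowed k.+2 6) (window_allowed k.+3 4).
move: (no_triple_grow k) (no_stay k.+2) (no_stay k.+3) (no_stay k.+4).
move: (no_stay k.+4.+1) => /=.
case: (m k.+2) => //; case: (m k.+3) => //; case: (m k.+4) => //.
by case: (m k.+4.+1) => //; case: (m k.+4.+2) => //; case: (m k.+4.+3).
Qed.

Lemma grow_swap_swap k :
  m k.+2 = Grow -> m k.+3 = Swap /\ m k.+4 = Swap.
Proof.
move=> G2; move: (window_allowed k.+2 4) (no_double_grow k).
move: (no_stay k.+1) (no_stay k.+2) (no_stay k.+3) => /=.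
rewrite G2; case: (m k.+3) => //; case: (m k.+4) => //.
by case: (m k.+4.+1).
Qed.

Lemma exists_grow k : exists j, m (k + j) = Grow.
Proof.
apply: contrapT => H.
have S j : m (k + j).+2 = Swap.
  have := no_stay (k + j).
  by case E: (m _) => // _; case: H; exists j.+2; rewrite !addnS.
have := window_allowed k.+2 5; rewrite /=.
move: (S 0) (S 1) (S 2) (S 3) (S 4); rewrite !addnS !addn0.
by do 5![move=> ->].
Qed.

Lemma period_step k :
  [/\ m k.+2 = Swap, m k.+3 = Swap & m k.+4 = Grow] ->
  [/\ m k.+4.+1 = Swap, m k.+4.+2 = Swap, m k.+4.+3 = Swap
     & m k.+4.+4 = Grow].
Proof.
move=> [S2 S3 G4].
have [S5 S6] := @grow_swap_swap k.+2 G4.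
move: (window_allowed k.+2 7) (window_allowed k.+4 5).
move: (no_stay k.+4.+1) (no_stay k.+4.+2).
rewrite /= S2 S3 G4 S5 S6.
by case: (m k.+4.+3) => //; case: (m k.+4.+4).
Qed.

Lemma eventually_periodic k : exists2 k1, k <= k1 & forall j,
  [/\ m (k1 + 4 * j) = Swap, m (k1 + 4 * j).+1 = Swap,
      m (k1 + 4 * j).+2 = Swap & m (k1 + 4 * j).+3 = Grow].
Proof.
have [j0] := exists_grow k.+2; rewrite !addSn => G0.
have [S1 S2] := grow_swap_swap G0.
(* After [Grow Swap Swap] comes either [Grow], or one more [Swap] and then [Grow]. *)
have [k1 [kk1 P0]] : exists k1, k <= k1 /\
    [/\ m k1.+2 = Swap, m k1.+3 = Swap & m k1.+4 = Grow].
  case E: (m (k + j0).+4.+1).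
  - by have := no_stay (k + j0).+3; rewrite E.
  - exists (k + j0).+2; split; first by lia.
    split=> //; move: (window_allowed (k + j0).+2 5) (no_stay (k + j0).+4).
    by rewrite /= G0 S1 S2 E; case: (m _).
  - by exists (k + j0).+1; split; first by lia.
exists k1.+4.+1 => [|j]; first by lia.
elim: j => [|j [_ H2 H3 H4]].
  by rewrite muln0 addn0; exact: period_step.
have -> : k1.+4.+1 + 4 * j.+1 = (k1.+4 + 4 * j).+4.+1 by lia.
exact: (@period_step (k1.+4 + 4 * j) (And3 H2 H3 H4)).
Qed.

End Orbit.

(** * Desubstitution *)

Definition agree (A : Type) (x : nat -> A) (i j n : nat) : Prop :=
  forall k, k < n -> x (i + k) = x (j + k).

Lemma agree_sub (A : Type) (x : nat -> A) i j n n' :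
  n <= n' -> agree x i j n' -> agree x i j n.
Proof. by move=> le_n H k lt_k; apply: H; exact: leq_trans le_n. Qed.

Lemma agree_cat (A : Type) (x : nat -> A) i j a b i' j' n :
  i' = i + a -> j' = j + a -> n <= a + b ->
  agree x i j a -> agree x i' j' b -> agree x i j n.
Proof.
move=> -> -> le_n Ha Hb k lt_k; have [/Ha//|le_ak] := ltnP k a.
by rewrite -(subnKC le_ak) !addnA Hb //; lia.
Qed.

Lemma rfun_le (T : Type) (x : nat -> T) i j n :
  i < j -> agree x i j n -> rfun x n <= j + n.
Proof.
move=> lt_ij H; rewrite /rfun.
have C : `[< rcond x n (j + n) >].
  apply/asboolP; split; first by lia.
  exists i.+1; rewrite addnK; split=> //; split=> //.
  rewrite /Defs.factor addn1 /=; apply: (@eq_from_nth _ (x 0)).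
    by rewrite !size_mkseq.
  by move=> k; rewrite size_mkseq => lt_k; rewrite !nth_mkseq // H.
case: pselect => [ex|[]]; last by exists (j + n).
by case: ex_minnP => m _; apply.
Qed.

(* No word w has all four extensions awb; equivalently, there is at most one
   right special factor of each length. *)
Definition unispecial (y : nat -> bool) : Prop :=
  forall n (f : bool -> bool -> nat),
    (forall a b, [/\ y (f a b) = a, y (f a b + n).+1 = b
                   & agree y (f a b).+1 (f true true).+1 n]) -> False.

(** * Grouping the letters of a binary word *)

Section Derived.
Variables (D : bool) (y : nat -> bool).

(* [D] is the letter that may be repeated; grouping each [~~ D] with the [D]
   before it amounts to deleting every [D] that is followed by [~~ D].
   [ends k] is the index in [y] of the last letter of the [k]-th group. *)
Fixpoint ends (k : nat) : nat :=
  if k is k'.+1 then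
    if y (ends k').+2 == D then (ends k').+1 else (ends k').+2
  else if (y 0 == D) && (y 1 != D) then 1 else 0.

Definition derived (k : nat) : bool := y (ends k).

Hypothesis isolated : forall i, (y i == D) || (y i.+1 == D).

Lemma ends_next k : y (ends k).+1 = D.
Proof.
elim: k => [|k IH] /=.
  case: ifP => [/andP[_ /negPf H]|].
    by have := isolated 1; rewrite H => /eqP.
  by have := isolated 0; case: (y 0 =P D) => //= _; [case: eqP|move/eqP].
case: ifP => [/eqP //|H].
by have := isolated (ends k).+2; rewrite H => /eqP.
Qed.

Lemma derivedS k : derived k.+1 = y (ends k).+2.
Proof.
by rewrite /derived /=; case: ifP => // /eqP ->; rewrite ends_next.
Qed.

Lemma endsS k : ends k.+1 = ends k + (if derived k.+1 == D then 1 else 2).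
Proof. by rewrite derivedS /=; case: ifP => _; rewrite ?addn1 ?addn2. Qed.

(** Equal groups spell equal letters, and every group is followed by [D], which accounts for the
    extra letter in [l.+1]. *)
Lemma agree_ends n i j :
  agree derived i.+1 j.+1 n ->
  exists2 l, (ends (i + n) = ends i + l /\ ends (j + n) = ends j + l)
           & agree y (ends i).+1 (ends j).+1 l.+1.
Proof.
elim: n => [|n IH] H.
  exists 0; first by rewrite !addn0.
  by case=> // _; rewrite !addn0 !ends_next.
have [|l [Ei Ej] Hl] := IH; first exact: agree_sub H.
have E : derived (i + n).+1 = derived (j + n).+1 by rewrite -!addSn H.
have E' : y (ends (i + n)).+2 = y (ends (j + n)).+2 by rewrite -!derivedS.
exists (l + if derived (i + n).+1 == D then 1 else 2).
  by rewrite !addnS !endsS -E Ei Ej !addnA.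
have ni := ends_next (i + n).+1; have nj := ends_next (j + n).+1.
rewrite !endsS -E Ei Ej in ni nj; rewrite Ei Ej in E'.
move=> x; have [/Hl //|le_lx] := ltnP x l.+1.
have [->|ne_x] := eqVneq x l.+1; first by rewrite !addnS in E' *.
case: (derived _ == D) ni nj => ni nj lt_x; first lia.
have -> : x = l.+2 by lia.
have -> : (ends i).+1 + l.+2 = (ends i + l + 2).+1 by lia.
have -> : (ends j).+1 + l.+2 = (ends j + l + 2).+1 by lia.
by rewrite ni nj.
Qed.

(** Expanding groups turns four extensions of a word into four extensions of a longer one: the last
    letter of a group identifies it on the left, the letter after its initial [D] on the right. *)
Lemma derived_unispecial : unispecial y -> unispecial derived.
Proof.
move=> Hy n f Hf.
pose l := ends (f true true + n) - ends (f true true).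
apply: (Hy l.+1 (fun a b => ends (f a b))) => a b.
have [fa fb /agree_ends [l' [Ei Ej]]] := Hf a b.
have -> : l = l' by rewrite /l Ej addKn.
by move=> Hl; split=> //; rewrite addnS -Ei -derivedS.
Qed.

End Derived.

Record level := Level {
  len : bool -> nat;
  code : nat -> bool;
  cut : nat -> nat }.

(* The word [s] is a suffix of length [cut 0] of the block [code 0], followed by
   the blocks [code 1], [code 2], ..., where block [b] has length [len b] and
   block [code k] ends at position [cut k]. Every cut is followed by the same
   [len true + len false - 2] letters. *)
Record valid (T : Type) (s : nat -> T) (lv : level) : Prop := Valid {
  len_gt0 : forall b, 0 < len lv b;
  cut0_le : cut lv 0 <= len lv (code lv 0);
  cutS : forall k, cut lv k.+1 = cut lv k + len lv (code lv k.+1);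
  agree_cut : forall k l,
    agree s (cut lv k) (cut lv l) (len lv true + len lv false - 2);
  agree_block : forall k l, code lv k.+1 = code lv l.+1 ->
    agree s (cut lv k) (cut lv l) (len lv (code lv k.+1));
  agree_first : forall l, code lv l.+1 = code lv 0 ->
    agree s 0 (cut lv l + (len lv (code lv 0) - cut lv 0)) (cut lv 0);
  code_unispecial : unispecial (code lv) }.

Definition derive (D : bool) (lv : level) : level :=
  Level (fun b => if b == D then len lv D else len lv D + len lv (~~ D))
        (derived D (code lv)) (fun k => cut lv (ends D (code lv) k)).

Lemma lenTF (f : bool -> nat) D : f true + f false = f D + f (~~ D).
Proof. by case: D; rewrite //= addnC. Qed.

Lemma neq_negb (a D : bool) : (a == D) = false -> a = ~~ D.
Proof. by case: a; case: D. Qed.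

Section ValidLevel.
Variables (T : Type) (s : nat -> T) (lv : level).
Hypothesis lvP : valid s lv.
Local Notation L := (len lv).
Local Notation y := (code lv).
Local Notation t := (cut lv).

Lemma agree_block_cut k l : y k.+1 = y l.+1 ->
  agree s (t k) (t l) (L (y k.+1) + (L true + L false - 2)).
Proof.
move=> E; apply: agree_cat (agree_block lvP E) (agree_cut lvP k.+1 l.+1) => //.
  exact: (cutS lvP).
by rewrite (cutS lvP) E.
Qed.

Lemma agree_first_cut l : y l.+1 = y 0 ->
  agree s 0 (t l + (L (y 0) - t 0)) (t 0 + (L true + L false - 2)).
Proof.
move=> E; apply: agree_cat (agree_first lvP E) (agree_cut lvP 0 l.+1) => //.
have := cut0_le lvP; rewrite (cutS lvP) E; lia.
Qed.

Variable D : bool.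
Hypothesis isolated : forall i, (y i == D) || (y i.+1 == D).

Lemma valid_derive : valid s (derive D lv).
Proof.
have nx := ends_next isolated; have ds := derivedS isolated.
have L0 := len_gt0 lvP.
split=> /=.
- by move=> b; case: ifP => _ //; rewrite addn_gt0 L0.
- rewrite /derived /=; case: ifP => [/andP[/eqP y0 /negPf y1]|H].
    rewrite y1 (cutS lvP) (neq_negb y1).
    by have := cut0_le lvP; rewrite y0; lia.
  have := cut0_le lvP; case: eqP => [->//|/eqP/negPf/neq_negb ->]; lia.
- move=> k; rewrite ds /=; case: ifP => H.
    by rewrite (cutS lvP) nx.
  by rewrite !(cutS lvP) nx (neq_negb H) addnA.
(* Every new cut is followed by a block [D], so the common continuation gains [len lv D], and so
   does the sum of the two lengths. *)
- move=> k l; have E : y (ends D y k).+1 = y (ends D y l).+1 by rewrite !nx.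
  apply: agree_sub (agree_block_cut E); rewrite nx.
  by have := L0 true; have := L0 false; case: (D) => /=; lia.
- move=> k l; rewrite !ds => E2.
  have E : y (ends D y k).+1 = y (ends D y l).+1 by rewrite !nx.
  case: ifP => H.
    by have := agree_block lvP E; rewrite nx.
  apply: agree_cat (agree_block lvP E) (agree_block lvP E2);
    rewrite ?(cutS lvP) //.
    by rewrite E.
  by rewrite nx (neq_negb H).
- move=> l; rewrite ds /derived [ends _ _ 0]/=.
  (* The first group is either [D] then [~~ D], truncated in its [D], or a single letter; a lone
     [~~ D] is a group lacking its [D]. *)
  case: ifP => [/andP[/eqP y0 y1] /= E|].
    rewrite (negPf y1) (cutS lvP).
    have E0 : y (ends D y l).+1 = y 0 by rewrite nx.
    have E1 : y 1 = y (ends D y l).+2 by rewrite E.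
    have /= F0 := agree_first lvP E0; have le0 := cut0_le lvP.
    rewrite (neq_negb (negPf y1)) subnDr -[in L D]y0.
    apply: agree_cat F0 (agree_block lvP E1) => //.
      by rewrite (cutS lvP) nx y0 in le0 *; lia.
    by rewrite (neq_negb (negPf y1)).
  move=> H /= E; case: eqP E H => [y0|/eqP/negPf/neq_negb y0] E H.
    have E0 : y (ends D y l).+1 = y 0 by rewrite nx.
    by have := agree_first lvP E0; rewrite y0.
  have := agree_first lvP E; rewrite y0 (cutS lvP) nx.
  have := cut0_le lvP; rewrite y0 => le0.
  by rewrite -addnA addnBA.
- exact: derived_unispecial (code_unispecial lvP).
Qed.

End ValidLevel.

(** * Repetitions at one level *)

Definition repeated (lv : level) : bool :=
  `[< exists i, code lv i && code lv i.+1 >].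

Definition config (lv : level) : nat * nat * nat :=
  (len lv (code lv 0), len lv (~~ code lv 0), cut lv 0).

Definition move_of (lv : level) : move :=
  if code lv 1 == code lv 0 then Stay
  else if code lv 0 == repeated lv then Swap else Grow.

Section Bounds.
Variables (T : Type) (s : nat -> T) (N : nat).
Hypothesis rfun_ge : forall n, N <= n -> 1662 * n <= 1000 * rfun s n.

(** [rfun_ge] yields [662 * (n - 2) <= 1000 * j]; for [n >= 662] lowering the slope to 33/50 absorbs
    the two lost letters. *)
Lemma agree_rate i j n :
  i < j -> N + 662 <= n -> agree s i j (n - 2) -> 33 * n <= 50 * j.
Proof.
move=> lt_ij le_n /(rfun_le lt_ij) H.
by have := rfun_ge (_ : N <= n - 2); lia.
Qed.

Section OneLevel.
Variable lv : level.
Hypothesis lvP : valid s lv.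
Local Notation L := (len lv).
Local Notation y := (code lv).
Local Notation t := (cut lv).
Local Notation D := (repeated lv).

(** Otherwise [s] is eventually periodic, and arbitrarily long repetitions start at a fixed
    position, against [rfun_ge]. *)
Lemma not_eventually_constant k : exists2 i, k <= i & y i.+1 != y i.
Proof.
apply: contrapT => H.
have yS i : k <= i -> y i.+1 = y i.
  by move=> le_ki; apply/eqP; apply/negPn/negP => ne; apply: H; exists i.
have A m i : k <= i -> agree s (t i) (t i.+1) (m * L (y i.+1)).
  elim: m i => [|m IH] i le_ki; first by move=> x; rewrite mul0n.
  have E : y i.+1 = y i.+2 by rewrite (yS i.+1) // ltnW.
  have := IH i.+1 (leqW le_ki); rewrite -E.
  by apply: agree_cat (agree_block lvP E); rewrite ?(cutS lvP) ?E ?mulSn.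
have lt_t : t k < t k.+1.
  by rewrite (cutS lvP) -addn1 leq_add2l (len_gt0 lvP).
pose n := N + (2 * t k.+1).+1.
have An := A n k (leqnn k).
have := rfun_le lt_t (agree_sub (leq_pmulr n (len_gt0 lvP _)) An).
by have := rfun_ge (_ : N <= n); rewrite /n; lia.
Qed.

(** If both letters were repeated, then, each being also followed by the other, all four extensions
    of the empty word would occur. *)
Lemma repeated_isolated i : (y i == D) || (y i.+1 == D).
Proof.
rewrite /repeated; case: asboolP => [[iT /andP[T0 T1]]|nT]; last first.
  apply/negPn/negP; case E: (y i); case E': (y i.+1) => //= _.
  by case: nT; exists i; rewrite E E'.
case F0: (y i) => //; case F1: (y i.+1) => //.
have change k : exists2 j, k <= j & [/\ y j = y k & y j.+1 = ~~ y k].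
  have [j le_kj ne] := not_eventually_constant k.
  have ex : exists j, (k <= j) && (y j.+1 != y j) by exists j; rewrite le_kj.
  case: (ex_minnP ex) => m /andP[le_km nem] minm.
  have const l : k + l <= m -> y (k + l) = y k.
    elim: l => [|l IH] le_l; first by rewrite addn0.
    rewrite addnS -IH ?(leq_trans _ le_l) ?addnS //.
    apply/eqP/negPn/negP => ne'.
    have := minm (k + l).
    by rewrite leq_addr ne' leqNgt -addnS le_l => /(_ isT).
  exists m => //.
  have Em : y m = y k by rewrite -(subnKC le_km) const // subnKC.
  by split=> //; rewrite -Em (neq_negb (negbTE nem)).
have [jT _ [jT0 jT1]] := change iT; have [jF _ [jF0 jF1]] := change i.
case: (code_unispecial lvP (n := 0) (f := fun a b =>
   if a then if b then iT else jT else if b then jF else i)).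
by case=> -[]; split;
  rewrite ?addn0 ?jT0 ?jT1 ?jF0 ?jF1 ?T0 ?T1 ?F0 ?F1 // => k.
Qed.

(** The first group is [D] for [Stay], [D] then [~~ D] for [Swap], and a lone [~~ D] for [Grow]. *)
Lemma config_derive : config (derive D lv) = act (move_of lv) (config lv).
Proof.
have iso := repeated_isolated.
rewrite /config /move_of /= /derived /=.
have := iso 0; case E0: (y 0 == D) => /=.
  move=> _; case E1: (y 1 == D) => /=.
    by rewrite (eqP E0) (eqP E1) eqxx; case: (D) => //=; rewrite addnC.
  rewrite (eqP E0) E1 (neq_negb E1) (cutS lvP) (neq_negb E1) negbK eqxx.
  by case: (D).
move=> /eqP ->; rewrite (neq_negb E0) negbK eqxx.
by case: (D) => /=; rewrite addnC.
Qed.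

Lemma config_reduced : reduced (config lv).
Proof. by split; [exact: (len_gt0 lvP)..|exact: (cut0_le lvP)]. Qed.

(** Here the code starts with [D], [~~ D], [D], so the first block recurs after a shift by one block
    of each kind. *)
Lemma agree_swap : move_of lv = Swap ->
  agree s 0 (L true + L false) (cut lv 0 + (L true + L false) - 2).
Proof.
rewrite /move_of; case: ifP => // E1; case: ifP => // /eqP E0 _.
have E2 : y 2 = y 0.
  by have := repeated_isolated 1; rewrite -E0 E1 => /eqP.
have := agree_first_cut lvP E2; rewrite (cutS lvP) (neq_negb E1).
have := cut0_le lvP; rewrite (lenTF L (y 0)) => le0.
have := len_gt0 lvP (y 0); have := len_gt0 lvP (~~ y 0) => v0 u0.
have -> : t 0 + L (~~ y 0) + (L (y 0) - t 0) = L (y 0) + L (~~ y 0) by lia.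
by apply: agree_sub; lia.
Qed.

Hypothesis large : N + 662 <= L true + L false.

Lemma config_bound : bound (move_of lv) (config lv).
Proof.
have u0 := len_gt0 lvP (y 0); have v0 := len_gt0 lvP (~~ y 0).
have := large; rewrite (lenTF L (y 0)) => large'.
case E: (move_of lv) => //=.
  move: E; rewrite /move_of; case: ifP => [/eqP E _|]; last by case: ifP.
  apply: (@agree_rate 0) => //; first by lia.
  have := agree_first_cut lvP E; have := cut0_le lvP => le0.
  by rewrite subnKC // (lenTF L (y 0)); apply: agree_sub; lia.
apply: (@agree_rate 0); try lia.
have := agree_swap E; rewrite (lenTF L (y 0)).
by apply: agree_sub; lia.
Qed.

(** The hypothesis forces equal blocks 1 and 2 for [Grow], 1 and 3 for [Stay], 2 and 3 for [Swap];
    the repetition extends over the letters common to all cuts. *)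
Lemma config_next : move_of (derive D lv) != Stay ->
  next_bound (move_of lv) (config lv).
Proof.
have iso := repeated_isolated; have ds := derivedS iso.
have u0 := len_gt0 lvP (y 0); have v0 := len_gt0 lvP (~~ y 0).
have := large; rewrite (lenTF L (y 0)) => large' H.
have {H} : derived D y 1 != derived D y 0.
  by move: H; rewrite /move_of /=; case: ifP.
rewrite ds /derived /= /move_of.
have [E0|ne0] := eqVneq (y 0) D; last first.
  have E1 : y 1 = ~~ y 0.
    have := iso 0; rewrite (negPf ne0) => /eqP ->.
    by case: (y 0) (D) ne0 => [] [].
  rewrite E1 /= => ne; have {ne} E2 : y 2 = ~~ y 0 by apply/neq_negb/negbTE.
  have -> : (~~ y 0 == y 0) = false by case: (y 0).
  apply: (@agree_rate (t 0)); try lia.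
  have E12 : y 1 = y 2 by rewrite E1.
  have := agree_block_cut lvP E12; rewrite (cutS lvP) E1 (lenTF L (y 0)).
  by rewrite [_ + t 0]addnC; apply: agree_sub; lia.
rewrite -E0; have [E1|ne1] := eqVneq (y 1) (y 0).
  rewrite /= => ne2.
  have {ne2} E2 : y 2 = ~~ y 0 by apply/neq_negb/negbTE.
  have E3 : y 3 = y 0.
    by have := iso 2; rewrite E2 -E0 => /orP[/eqP|/eqP //]; case: (y 0).
  apply: (@agree_rate (t 0)); try lia.
  have E13 : y 1 = y 3 by rewrite E1.
  have := agree_block_cut lvP E13; rewrite !(cutS lvP) E1 E2 (lenTF L (y 0)).
  rewrite [_ + t 0]addnC addnA; apply: agree_sub; lia.
have {}ne1 : y 1 = ~~ y 0 by apply/neq_negb/negbTE.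
rewrite /= ne1 => ne3; have {ne3} E3 : y 3 = y 0.
  by apply/eqP; move: ne3; case: (y 3); case: (y 0).
have E2 : y 2 = y 0.
  by have := iso 1; rewrite ne1 -E0 => /orP[/eqP|/eqP //]; case: (y 0).
apply: (@agree_rate (t 1)).
- by rewrite (cutS lvP) ne1; lia.
- by lia.
have E23 : y 2 = y 3 by rewrite E2.
have := agree_block_cut lvP E23; rewrite !(cutS lvP) ne1 E2 (lenTF L (y 0)).
have -> : t 0 + L (~~ y 0) + L (y 0) = L (y 0) + L (~~ y 0) + t 0 by lia.
by apply: agree_sub; lia.
Qed.

End OneLevel.
End Bounds.

(** * Sturmian words *)

Section SturmianCode.
Variables (T : finType) (s : nat -> T).
Hypothesis sturm : sturmian s.

Let ftuple (n i : nat) : n.-tuple T := [tuple s (i + k) | k < n].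

Lemma ftupleP n (w : n.-tuple T) :
  reflect (exists i, w = ftuple n i) (w \in factors_of_length s n).
Proof.
have fE i : tval (ftuple n i) = Defs.factor s i.+1 n.
  rewrite /Defs.factor /mkseq -val_enum_ord -map_comp /=.
  exact: eq_map.
rewrite inE; apply: (iffP (asboolP _)) => [[[|i] [// _ E]]|[i ->]].
  by exists i; apply: val_inj; exact: etrans (esym E) (esym (fE i)).
by exists i.+1; rewrite fE.
Qed.

Lemma ftuple_factor n i : ftuple n i \in factors_of_length s n.
Proof. by apply/ftupleP; exists i. Qed.

Lemma eq_ftuple n i j : ftuple n i = ftuple n j <-> agree s i j n.
Proof.
split=> [E k lt_k|H]; last first.
  by apply: eq_from_tnth => k; rewrite !tnth_mktuple H.
by have := congr1 (fun w => tnth w (Ordinal lt_k)) E; rewrite !tnth_mktuple.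
Qed.

Definition letter (i : nat) : bool := s i == s 0.

Lemma letter_inj i j : letter i = letter j -> s i = s j.
Proof.
rewrite /letter; case: (s i =P s 0) => [-> /esym/eqP //|ni /esym/eqP nj].
apply/eqP/negPn/negP => nij.
have n1 a b : s a != s b -> ftuple 1 a != ftuple 1 b.
  apply: contraNN => /eqP/eq_ftuple/(_ 0 isT).
  by rewrite !addn0 => ->; exact: eqxx.
have : #|[set ftuple 1 0; ftuple 1 i; ftuple 1 j]| <= 2.
  rewrite -(sturm (leqnn 1)); apply: subset_leq_card.
  apply/fintype.subsetP => w; rewrite !finset.in_setU !finset.in_set1.
  by case/orP=> [/orP[]|] /eqP ->; exact: ftuple_factor.
rewrite finset.setUC cardsU1 cards2 !inE !negb_or.
by rewrite ![ftuple 1 j == _]eq_sym !n1 //; apply/eqP => // /esym.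
Qed.

(** Deleting the last letter maps factors of length [n + 2] onto those of length [n + 1]. Four
    extensions would cause two coincidences, but the two complexities differ by one. *)
Lemma letter_unispecial : unispecial letter.
Proof.
move=> n f Hf.
pose g (w : n.+2.-tuple T) : n.+1.-tuple T :=
  [tuple tnth w (widen_ord (leqnSn n.+1) k) | k < n.+1].
have gE i : g (ftuple n.+2 i) = ftuple n.+1 i.
  by apply: eq_from_tnth => k; rewrite !tnth_mktuple.
pose W a b := ftuple n.+2 (f a b).
have WP a b a' b' : W a b = W a' b' -> a = a' /\ b = b'.
  move/eq_ftuple => E.
  have [Ea Eb _] := Hf a b; have [Ea' Eb' _] := Hf a' b'.
  split; [apply: etrans (esym Ea) (etrans _ Ea')
         |apply: etrans (esym Eb) (etrans _ Eb')]; rewrite /letter.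
    by have := E 0 isT; rewrite !addn0 => ->.
  by have := E n.+1 (leqnn _); rewrite !addnS => ->.
have gW a : g (W a true) = g (W a false).
  rewrite !gE; apply/eq_ftuple => -[|k] lt_k.
    have [Et _ _] := Hf a true; have [Ef _ _] := Hf a false.
    by rewrite !addn0; apply: letter_inj; rewrite Et Ef.
  have [_ _ At] := Hf a true; have [_ _ Af] := Hf a false.
  by rewrite -!addSnnS; apply: letter_inj; rewrite At ?Af.
pose A := factors_of_length s n.+2 :\ W true true :\ W false true.
have : #|factors_of_length s n.+1| <= #|A|.
  apply: leq_trans (leq_imset_card g A); apply: subset_leq_card.
  apply/fintype.subsetP => w /ftupleP[i ->]; rewrite -gE.
  have AW a : W a false \in A.
    rewrite !inE -/(W a false) (_ : `[< _ >] = true) ?andbT; last first.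
      by have := ftuple_factor n.+2 (f a false); rewrite inE.
    by apply/andP; split; apply/eqP => /WP[].
  have [/eqP E|n1] := boolP (ftuple n.+2 i == W true true).
    by rewrite E gW; apply: imset_f; exact: AW.
  have [/eqP E|n2] := boolP (ftuple n.+2 i == W false true).
    by rewrite E gW; apply: imset_f; exact: AW.
  apply: imset_f.
  by rewrite finset.in_setD1 n2 finset.in_setD1 n1 ftuple_factor.
have := cardsD1 (W true true) (factors_of_length s n.+2).
have := cardsD1 (W false true) (factors_of_length s n.+2 :\ W true true).
rewrite finset.in_setD1 !ftuple_factor andbT.
have -> : W false true != W true true by apply/eqP => /WP[].
have := sturm (isT : 0 < n.+1); have := sturm (isT : 0 < n.+2).
by rewrite /complexity /A => -> -> /= ->; rewrite !add1n => -[<-]; rewrite ltnn.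
Qed.

Lemma letter_valid : valid s (Level (fun=> 1) letter succn).
Proof.
split=> //=; first by move=> k; rewrite addn1.
- move=> k l E [|x] // _; rewrite !addn0; exact: letter_inj.
- by move=> l E [|x] // _; rewrite subnn !addn0; apply: letter_inj.
- exact: letter_unispecial.
Qed.

End SturmianCode.

(** * Limit inferior and growth along the periodic sequence *)

Local Open Scope ring_scope.

Lemma limn_einf_gt (R : realType) (u : nat -> R) (c : R) :
  (c%:E < limn_einf (fun n => (u n)%:E))%E ->
  exists2 c', c < c' & exists N, forall n, (N <= n)%N -> c' <= u n.
Proof.
(* The limit inferior is the supremum of the tail infima; a tail infimum above [c] serves as
   [c']. *)
rewrite limn_einf_lim (cvg_lim _ (@cvg_einfs_sup _ _)) //.
move=> /ereal_sup_gt[_ [N _ <-]] lt_c.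
have le_e n : (N <= n)%N -> (einfs (fun n => (u n)%:E) N <= (u n)%:E)%E.
  by move=> le_n; apply: ereal_inf_lbound; exists n.
case: (einfs _ N) lt_c le_e => [e| |] //.
- rewrite lte_fin => lt_c le_e; exists e => //.
  by exists N => n /le_e; rewrite lee_fin.
- by move=> _ /(_ N (leqnn N)).
Qed.

(* The linear recurrence has eigenvalues 3 + sqrt 10, 3 - sqrt 10 and 1; for
   c' = sqrt 10 - 5/2 the first one drops out of the difference of the two sides
   of the inequality, which therefore stays bounded. *)
Lemma periodic_bound (R : realType) (c' : R) (u v d : nat -> nat) :
  (0 < u 0)%N ->
  (forall j, [/\ u j.+1 = 5 * u j + 3 * v j, v j.+1 = 2 * u j + v j
              & d j.+1 = d j + 2 * u j + 2 * v j]%N) ->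
  (forall j, c' * (4 * (u j)%:R + 3 * (v j)%:R + (d j)%:R - 2) <=
             3 * (u j)%:R + 2 * (v j)%:R) ->
  c' <= Num.sqrt 10 - 5 / 2.
Proof.
move=> u0 rec ineq; rewrite leNgt; apply/negP => lt_c.
set q : R := Num.sqrt 10 in lt_c *.
have q2 : q * q = 10 by rewrite -expr2 sqr_sqrtr //; lra.
have q0 : 3 <= q by rewrite -[3]ger0_norm // -sqrtr_sqr ler_wsqrtr //; lra.
have q4 : q <= 4 by nra.
pose U j : R := (u j)%:R; pose V j : R := (v j)%:R; pose E j : R := (d j)%:R.
have recU j : U j.+1 = 5 * U j + 3 * V j.
  by rewrite /U; have [-> _ _] := rec j; rewrite natrD !natrM.
have recV j : V j.+1 = 2 * U j + V j.
  by rewrite /V; have [_ -> _] := rec j; rewrite natrD !natrM.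
have recE j : E j.+1 = E j + 2 * U j + 2 * V j.
  by rewrite /E; have [_ _ ->] := rec j; rewrite natrD natrD !natrM.
have U0 j : 0 <= U j by [].
have V0 j : 0 <= V j by [].
have E0 j : 0 <= E j by [].
have Uj j : j%:R + 1 <= U j.
  elim: j => [|j IH]; first by rewrite add0r /U (ler_nat _ 1).
  rewrite recU -natr1; have := V0 j; have := ler0n R j; lra.
(* A left eigenvector for [3 - q], of modulus below 1; [K] below is the invariant for eigenvalue
   1. *)
pose w j := U j - (1 + q / 2) * V j.
have w_le j : `|w j| <= `|w 0%N|.
  elim: j => // j IH; apply: le_trans IH.
  have -> : w j.+1 = (3 - q) * w j.
    rewrite /w recU recV.
    have -> : (3 - q) * (U j - (1 + q / 2) * V j) =
       (3 - q) * U j - (3 + q / 2 - (q * q) / 2) * V j by field.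
    by rewrite q2; field.
  rewrite normrM ler_piMl //; apply/ler_normlP; split; lra.
pose K := 3 * E 0%N + V 0%N - 2 * U 0%N.
have KE j : 3 * E j + V j - 2 * U j = K.
  by elim: j => // j <-; rewrite recE recU recV; ring.
pose e := c' - (q - 5 / 2); have e0 : 0 < e by rewrite /e subr_gt0.
pose B := 12 * `|w 0%N| + `|K| + 2 * c'.
(* This bound contradicts [U j >= j + 1] for large [j]. *)
have XB j : e * U j <= B.
  have X0 : U j <= 4 * U j + 3 * V j + E j.
    by have := U0 j; have := V0 j; have := E0 j; lra.
  apply: le_trans (_ : e * (4 * U j + 3 * V j + E j) <= _).
    by rewrite ler_pM2l.
  have := ineq j; rewrite -/(U j) -/(V j) -/(E j) => ij.
  have eq : 3 * U j + 2 * V j - (q - 5 / 2) * (4 * U j + 3 * V j + E j) =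
            (44 - 14 * q) / 3 * w j - (q - 5 / 2) * K / 3.
    rewrite -(KE j) /w.
    have -> : (44 - 14 * q) / 3 * (U j - (1 + q / 2) * V j) =
       (44 - 14 * q) / 3 * U j - (44 + 8 * q - 7 * (q * q)) / 3 * V j by field.
    by rewrite q2; field.
  have hw : (44 - 14 * q) / 3 * w j <= 12 * `|w 0%N|.
    apply: le_trans (ler_norm _) _; rewrite normrM.
    apply: ler_pM => //; apply/ler_normlP; split; lra.
  have hK : - ((q - 5 / 2) * K / 3) <= `|K|.
    have := ler_norm K; have := ler_norm (- K); rewrite normrN; nra.
  rewrite /e /B; lra.
have := archi_boundP (_ : 0 <= B / e); set j := Num.bound _.
have B0 : 0 <= B by apply: le_trans (XB 0%N); rewrite mulr_ge0 // ltW.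
rewrite divr_ge0 ?(ltW e0) // => /(_ isT); rewrite ltr_pdivrMr //.
have := XB j; have := Uj j => h1 h2 h3.
have : j%:R * e <= e * U j by rewrite mulrC ler_pM2l //; lra.
lra.
Qed.

(** * Iterated desubstitution of a Sturmian word *)

Section Levels.
Local Open Scope nat_scope.
Variables (T : finType) (s : nat -> T) (N : nat).
Hypothesis sturm : sturmian s.
Hypothesis rfun_ge : forall n, N <= n -> 1662 * n <= 1000 * rfun s n.

Definition levels (k : nat) : level :=
  iter k (fun lv => derive (repeated lv) lv) (Level (fun=> 1) (letter s) succn).

Lemma levels_valid k : valid s (levels k).
Proof.
elim: k => [|k IH] /=; first exact: letter_valid.
exact: (valid_derive IH (repeated_isolated rfun_ge IH)).
Qed.

Lemma levels_large k : k <= len (levels k) true + len (levels k) false.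
Proof.
elim: k => // k IH /=.
have := len_gt0 (levels_valid k) true; have := len_gt0 (levels_valid k) false.
by case: (repeated _) => /=; lia.
Qed.

(** From this level on, the total block length meets the threshold of [agree_rate]. *)
Let start := N + 662.
Let lv k := levels (start + k).

Let lv_large k : N + 662 <= len (lv k) true + len (lv k) false.
Proof. by apply: leq_trans (levels_large _); rewrite leq_addr. Qed.

(** The triple is read at the start of each period [Swap Swap Swap Grow]; the repetition is that of
    [agree_swap] at the third [Swap]. *)
Lemma periodic_repetitions : exists u v d : nat -> nat,
  [/\ forall j, 0 < u j,
      forall j, [/\ u j.+1 = 5 * u j + 3 * v j, v j.+1 = 2 * u j + v j
              & d j.+1 = d j + 2 * u j + 2 * v j]
    & forall j, N <= 4 * u j + 3 * v j + d j - 2 /\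
        agree s 0 (3 * u j + 2 * v j) (4 * u j + 3 * v j + d j - 2)].
Proof.
pose c k := config (lv k); pose m k := move_of (lv k).
have lvP k : valid s (lv k) by exact: levels_valid.
have cS k : c k.+1 = act (m k) (c k).
  by rewrite /c /lv addnS; exact: (config_derive rfun_ge (lvP k)).
have red k : reduced (c k) := config_reduced (lvP k).
have bnd k : bound (m k) (c k) := config_bound rfun_ge (lvP k) (lv_large k).
have nxt k : m k.+1 != Stay -> next_bound (m k) (c k).
  by rewrite /m /lv addnS; exact: (config_next rfun_ge (lvP k) (lv_large k)).
have [k1 _ per] := eventually_periodic cS red bnd nxt 0.
pose C j := c (k1 + 4 * j).
have CE j : C j = ((C j).1.1, (C j).1.2, (C j).2) by case: (C j) => [[]].
exists (fun j => (C j).1.1), (fun j => (C j).1.2), (fun j => (C j).2).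
have C2 j : c (k1 + 4 * j).+2 = act Swap (act Swap (C j)).
  by have [m0 m1 _ _] := per j; rewrite !cS m0 m1.
split=> j.
- by have := red (k1 + 4 * j); rewrite -/(C j) CE => -[].
- have -> : C j.+1 = act Grow (act Swap (c (k1 + 4 * j).+2)).
    have [_ _ m2 m3] := per j.
    by rewrite /C mulnS addnCA 4!addSn add0n [in LHS]cS m3 [in LHS]cS m2.
  by rewrite C2 CE /=; split; lia.
- have [_ _ m2 _] := per j.
  have := agree_swap rfun_ge (lvP _) m2; have := lv_large (k1 + 4 * j).+2.
  have := C2 j; rewrite CE /c /config /=.
  rewrite (lenTF _ (code (lv (k1 + 4 * j).+2) 0)).
  case=> -> -> -> large A; split; first by lia.
  have e : 3 * (C j).1.1 + 2 * (C j).1.2 =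
     (C j).1.1 + (C j).1.2 + (C j).1.1 + ((C j).1.1 + (C j).1.2) by lia.
  by rewrite e; apply: agree_sub A; lia.
Qed.

End Levels.

Theorem theorem3p4 (R : realType) (T : finType) (s : nat -> T) :
  sturmian s -> (rep R s <= (Num.sqrt (10 : R) - 3 / 2)%:E)%E.
Proof.
move=> sturm; rewrite leNgt; apply/negP => /limn_einf_gt[c lt_c [N0 le_c]].
have c_ge : 1662 / 1000 <= c.
  suff : 3162 / 1000 <= Num.sqrt (10 : R) by lra.
  rewrite -[3162 / 1000]ger0_norm; last by lra.
  by rewrite -sqrtr_sqr ler_wsqrtr //; lra.
(* Starting at [N0.+1] keeps the division by [n] away from zero. *)
have rfun_c n : (N0.+1 <= n)%N -> c * n%:R <= (rfun s n)%:R.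
  move=> le_n; have n0 : (0 < n)%N by exact: leq_trans le_n.
  by have := le_c n (ltnW le_n); rewrite ler_pdivlMr // ltr0n.
have rfun_ge n : (N0.+1 <= n)%N -> (1662 * n <= 1000 * rfun s n)%N.
  move=> /rfun_c h; rewrite -(ler_nat R) !natrM.
  by have := ler_wpM2r (ler0n R n) c_ge; lra.
have [u [v [d [u0 rec agr]]]] := periodic_repetitions sturm rfun_ge.
(* A repetition of length [n] at position [p] gives [c * n <= p + n], hence the slope [c - 1]. *)
suff : c - 1 <= Num.sqrt 10 - 5 / 2 by lra.
apply: (periodic_bound (u0 0%N) rec) => j.
have [le_n A] := agr j.
have := rfun_le (_ : 0 < 3 * u j + 2 * v j)%N A; rewrite addn_gt0 muln_gt0 u0.
move=> /(_ isT); rewrite -(ler_nat R) => h.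
have := rfun_c _ le_n.
have le2 : (2 <= 4 * u j + 3 * v j + d j)%N by have := u0 j; lia.
have nE : (4 * u j + 3 * v j + d j - 2)%N%:R =
          4 * (u j)%:R + 3 * (v j)%:R + (d j)%:R - 2 :> R.
  by rewrite natrB // natrD natrD !natrM.
by move: h; rewrite natrD nE natrD !natrM; lra.
Qed.
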